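(* The class of claw-free Berge graphs has the strong Erdős–Hajnal property: there exists $\delta>0$ such that every claw-free Berge graph $G$ with at least two vertices has a homogeneous pair $(P,Q)$ with $|P|,|Q|\geq \delta|V(G)|$.
   Context: All graphs are finite and simple. The claw is the star with three leaves ($K_{1,3}$); a graph is claw-free if it has no induced claw. A hole is an induced cycle of length at least $4$, an antihole is the complement of a hole, and a graph is Berge if it contains no odd hole and no odd antihole as an induced subgraph. For disjoint vertex sets $P,Q$, $(P,Q)$ is a homogeneous pair if either all edges between $P$ and $Q$ are present or none are. *)

(* Defs.v *)
(* MathComp, with mathcomp-analysis [realType] for the real constant. *)
From HB Require Import structures.
From mathcomp Require Import all_boot all_order all_algebra.
From mathcomp Require Import reals.

Set Implicit Arguments.
Unset Strict Implicit.
Unset Printing Implicit Defensive.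

Import Order.TTheory GRing.Theory Num.Theory.

Record sgraph := SGraph {
  vertex :> finType;
  edge : rel vertex;
  edge_sym : symmetric edge;
  edge_irrefl : irreflexive edge }.

Definition compl_edge (G : sgraph) : rel G :=
  fun x y => (x != y) && ~~ edge x y.

Lemma compl_edge_sym G : symmetric (@compl_edge G).
Proof. by move=> x y; rewrite /compl_edge eq_sym edge_sym. Qed.

Lemma compl_edge_irrefl G : irreflexive (@compl_edge G).
Proof. by move=> x; rewrite /compl_edge eqxx. Qed.

Definition compl_graph (G : sgraph) : sgraph :=
  SGraph (@compl_edge_sym G) (@compl_edge_irrefl G).

(* [None] is the centre, the [Some i] are the [n] leaves. *)
Definition star_edge (n : nat) : rel (option 'I_n) :=
  fun x y => isSome x (+) isSome y.

Lemma star_edge_sym n : symmetric (@star_edge n).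
Proof. by move=> x y; rewrite /star_edge addbC. Qed.

Lemma star_edge_irrefl n : irreflexive (@star_edge n).
Proof. by move=> x; rewrite /star_edge addbb. Qed.

Definition star (n : nat) : sgraph :=
  SGraph (@star_edge_sym n) (@star_edge_irrefl n).

Definition claw : sgraph := star 3.

(* [ordS i] is the cyclic successor [i + 1 mod n]. The conjunct [i != j] only
   matters for [n = 1]; for [n >= 3] this is the cycle of length [n]. *)
Definition cycle_edge (n : nat) : rel 'I_n :=
  fun i j => (i != j) && ((j == ordS i) || (i == ordS j)).

Lemma cycle_edge_sym n : symmetric (@cycle_edge n).
Proof. by move=> i j; rewrite /cycle_edge eq_sym orbC. Qed.

Lemma cycle_edge_irrefl n : irreflexive (@cycle_edge n).
Proof. by move=> i; rewrite /cycle_edge eqxx. Qed.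

Definition cycle_graph (n : nat) : sgraph :=
  SGraph (@cycle_edge_sym n) (@cycle_edge_irrefl n).

(* [G] has an induced subgraph isomorphic to [H]. *)
Definition has_induced (H G : sgraph) : Prop :=
  exists2 f : H -> G, injective f & forall x y, edge (f x) (f y) = edge x y.

Definition claw_free (G : sgraph) : Prop := ~ has_induced claw G.

Definition has_hole (n : nat) (G : sgraph) : Prop :=
  4 <= n /\ has_induced (cycle_graph n) G.

Definition has_antihole (n : nat) (G : sgraph) : Prop :=
  4 <= n /\ has_induced (compl_graph (cycle_graph n)) G.

Definition berge (G : sgraph) : Prop :=
  forall n : nat, odd n -> ~ has_hole n G /\ ~ has_antihole n G.

Definition homogeneous_pair (G : sgraph) (P Q : {set G}) : Prop :=
  [disjoint P & Q] /\
  ((forall x y, x \in P -> y \in Q -> edge x y) \/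
   (forall x y, x \in P -> y \in Q -> ~~ edge x y)).

Definition strong_erdos_hajnal (R : realType) (C : sgraph -> Prop) : Prop :=
  exists2 delta : R, (0 < delta)%R &
    forall G : sgraph, C G -> 2 <= #|G| ->
      exists P Q : {set G},
        [/\ homogeneous_pair P Q,
            (delta * #|G|%:R <= #|P|%:R)%R &
            (delta * #|G|%:R <= #|Q|%:R)%R].

(* Main.v *)
(** If a vertex [v] has linear degree then, since its neighbourhood contains no
    stable triple and [G] has no odd antihole, the non-edges inside that
    neighbourhood form a bipartite graph; so [G] has a linear clique, any
    bisection of which is a complete pair.  Otherwise all degrees are small, and
    if there were no linear anticomplete pair, then vertex sets could be grown
    one vertex at a time so that they cover a prescribed fraction of a target.
    This produces disjoint linear sets [Y1], [Y2], [Y3] and sets [X1], [X2] such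
    that [Xi] covers [Yi] and has no other neighbour in the three sets.
    Claw-freeness then makes every triple [y1 ~ y2], [yi ~ z] with [z] in [Y3] a
    triangle, so a set [Z] inside [Y3] covering a proper fraction of [Y1] splits
    [Y1] and [Y2] into two parts without edges across. *)

Require Import Defs.
From mathcomp Require Import all_boot all_order all_algebra.
From mathcomp Require Import reals.
From mathcomp Require Import zify.

Set Implicit Arguments.
Unset Strict Implicit.
Unset Printing Implicit Defensive.

Import Order.TTheory GRing.Theory Num.Theory.

(** * Finite subsets of prescribed size *)

Lemma subset_of_card (T : finType) (A : {set T}) (k : nat) :
  k <= #|A| -> exists2 B : {set T}, B \subset A & #|B| = k.
Proof.
move=> kA; exists [set x in take k (enum A)].
  by apply/subsetP => x; rewrite inE => /mem_take; rewrite mem_enum.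
rewrite cardsE (card_uniqP _) ?take_uniq ?enum_uniq //.
by rewrite size_take -cardE; case: ltngtP kA.
Qed.

Lemma disjoint_setD (T : finType) (A C : {set T}) : [disjoint A & C :\: A].
Proof. by rewrite -setI_eq0 setDE setICA setICr setI0. Qed.

Lemma disjoint_setI_setD (T : finType) (A B C : {set T}) :
  [disjoint A :&: B & C :\: A].
Proof. exact: disjointWl (subsetIl _ _) (disjoint_setD _ _). Qed.

Lemma disjoint_halves (T : finType) (A : {set T}) (k : nat) : 2 * k <= #|A| ->
  exists B C : {set T},
    [/\ B \subset A, C \subset A, [disjoint B & C], #|B| = k & #|C| = k].
Proof.
move=> kA; have [|B BA cB] := @subset_of_card T A k; first by lia.
have [|C CA cC] := @subset_of_card T (A :\: B) k.
  by rewrite cardsD (setIidPr BA); lia.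
exists B, C; split=> //; first by apply: subset_trans CA (subsetDl _ _).
by rewrite disjoint_sym; move: CA; rewrite subsetD => /andP[].
Qed.

(** * Odd closed walks and two-colourings *)

Definition closed_walk (T : finType) (e : rel T) (n : nat) (w : nat -> T) :=
  w n = w 0 /\ forall k, k < n -> e (w k) (w k.+1).

(** The two new lengths add up to [n] and are both smaller than [n], so an odd [n] leaves a shorter
    odd closed walk. *)
Lemma closed_walk_split (T : finType) (e : rel T) (n i j : nat) (w : nat -> T) :
  closed_walk e n w -> i < j < n -> w i = w j ->
  (exists w', closed_walk e (j - i) w') /\
  (exists w', closed_walk e (n - (j - i)) w').
Proof.
move=> [wn we] /andP[ij jn] wij; split.
  exists (fun k => w (i + k)); split=> [|k kij].
    by rewrite addn0 wij; congr w; lia.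
  by rewrite addnS; apply: we; lia.
exists (fun k => if k <= i then w k else w (k + (j - i))); split=> [|k kn].
  by rewrite ifF ?leq0n -?wn; [congr w; lia | lia].
case: (ltngtP k i) => [ki|ik|ki].
- by apply: we; lia.
- by rewrite addSn; apply: we; lia.
- rewrite ki wij (_ : i.+1 + (j - i) = j.+1); last by lia.
  exact: we.
Qed.

(** The two new lengths add up to [n + 2], so again one is odd if [n] is; both are smaller than [n]
    unless the chord joins cyclically consecutive positions. *)
Lemma closed_walk_chord (T : finType) (e : rel T) (n i j : nat) (w : nat -> T) :
  symmetric e -> closed_walk e n w -> i < j < n -> e (w i) (w j) ->
  (exists w', closed_walk e (j - i).+1 w') /\
  (exists w', closed_walk e (n - (j - i)).+1 w').
Proof.
move=> e_sym [wn we] /andP[ij jn] eij; split.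
  exists (fun k => if k <= j - i then w (i + k) else w i); split=> [|k kij].
    by rewrite ifF ?addn0 //; lia.
  case: (ltngtP k (j - i)) => [kl|kl|->]; last by rewrite subnKC 1?e_sym // ltnW.
    by rewrite addnS; apply: we; lia.
  lia.
(* The chord replaces the segment from [i] to [j]: the shift [(j - i).-1] makes position [i.+1] read
   [w j]. *)
exists (fun k => if k <= i then w k else w (k + (j - i).-1)); split=> [|k kn].
  by rewrite ifF -?wn; [congr w; lia | lia].
case: (ltngtP k i) => [ki|ik|ki].
- by apply: we; lia.
- by rewrite addSn; apply: we; lia.
- by rewrite ki (_ : i.+1 + (j - i).-1 = j) //; lia.
Qed.

Lemma cycle_edge_lt (n : nat) (i j : 'I_n) : i < j ->
  cycle_edge i j = (j == i.+1 :> nat) || ((i == 0 :> nat) && (j == n.-1 :> nat)).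
Proof.
move=> ij; have jn := ltn_ord j; rewrite /cycle_edge -!val_eqE /=.
rewrite (modn_small (_ : i.+1 < n)); last by lia.
have [jn1|jn1] := eqVneq (j : nat) n.-1.
  by rewrite (_ : j.+1 = n) ?modnn; lia.
by rewrite modn_small; lia.
Qed.

(* A shortest odd closed walk is an induced cycle: a repeated vertex or a chord
   would split it into two shorter closed walks, one of them odd. *)
Lemma odd_closed_walk_induced (T : finType) (e : rel T) (n : nat) (w : nat -> T) :
  symmetric e -> irreflexive e -> odd n -> closed_walk e n w ->
  exists (m : nat) (f : 'I_m -> T), [/\ odd m, 3 <= m, injective f &
    forall i j, e (f i) (f j) = cycle_edge i j].
Proof.
move=> e_sym eirr; have [N] := ubnP n; elim: N n w => // N IH n w nN on clw.
case: (boolP [exists i : 'I_n, [exists j : 'I_n, (i < j) && ((w i == w j) ||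
    ((e (w i) (w j)) && ~~ cycle_edge i j))]]) => [|short].
  case/existsP=> i /existsP[j /andP[ij]]; have jn := ltn_ord j.
  case/orP => [/eqP wij | /andP[eij]].
    have [||[u cu] [v cv]] := @closed_walk_split _ _ _ i j w clw => //.
      by rewrite ij.
    have [o1|o1] := boolP (odd (j - i)); first by apply: IH cu => //; lia.
    by apply: IH cv => //; [lia | rewrite oddB ?on //; lia].
  rewrite cycle_edge_lt // => nc.
  have [||[u cu] [v cv]] := @closed_walk_chord _ _ _ i j w e_sym clw => //.
    by rewrite ij.
  have [o1|o1] := boolP (odd (j - i).+1); first by apply: IH cu => //; lia.
  by apply: IH cv => //; [lia | move: o1; rewrite /= oddB ?on //; lia].
have D (i j : 'I_n) : i < j -> w i <> w j /\ e (w i) (w j) = cycle_edge i j.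
  move=> ij; move: short; rewrite negb_exists => /forallP/(_ i).
  rewrite negb_exists => /forallP/(_ j); rewrite ij negb_or /= negb_and negbK.
  case/andP=> /eqP wij ec; split=> //; apply/idP/idP => [eij|].
    by move: ec; rewrite eij.
  have [wn we] := clw; have jn := ltn_ord j.
  rewrite cycle_edge_lt // => /orP[/eqP-> | /andP[/eqP-> /eqP->]].
    by apply: we; lia.
  by rewrite e_sym -wn -{2}(prednK (_ : 0 < n)) ?we; lia.
exists n, (fun i => w i); split=> //.
(* The only odd length below 3 is 1, and a closed walk of length 1 is a loop. *)
- case: n on clw {short D nN} => [|[|[|n]]] // _ [wn /(_ 0)].
  by rewrite wn eirr => /(_ isT).
- move=> i j wij; apply/val_inj.
  by case: (ltngtP i j) => // /D[]; rewrite wij.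
- move=> i j; case: (ltngtP i j) => [/D[]//|/D[_]|/val_inj ->].
    by rewrite e_sym cycle_edge_sym.
  by rewrite eirr cycle_edge_irrefl.
Qed.

(* Walks in the double cover [d] on [T * bool] record their parity; a vertex is
   coloured by the parity of the walks from the root of its component. *)
Lemma two_colouring (T : finType) (e : rel T) :
  symmetric e -> irreflexive e ->
  (forall (m : nat) (f : 'I_m -> T), odd m -> 3 <= m -> injective f ->
    ~ forall i j, e (f i) (f j) = cycle_edge i j) ->
  exists c : T -> bool, forall x y, e x y -> c x != c y.
Proof.
move=> e_sym eirr noodd.
pose d := [rel u v : T * bool | e u.1 v.1 && (u.2 != v.2)].
have dsym : connect_sym d.
  by apply: sym_connect_sym => u v /=; rewrite e_sym eq_sym.
(* Such a path in [d] flips the boolean at each step, so it projects to a closed walk of odd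
   length. *)
have noloop x : ~~ connect d (x, false) (x, true).
  apply/negP => /connectP[p dp lp].
  have [||m [f [om m3 fi fe]]] := @odd_closed_walk_induced T e (size p)
    (fun k => (nth (x, false) ((x, false) :: p) k).1) e_sym eirr.
  - have par k : k <= size p -> (nth (x, false) ((x, false) :: p) k).2 = odd k.
      elim: k => //= k IH kp; have /(_ k kp) := pathP (x, false) dp.
      rewrite /= => /andP[_]; rewrite IH 1?ltnW //.
      by case: (odd k); case: (nth _ _ _).2.
    by rewrite -par // nth_last /= -lp.
  - split; first by rewrite nth_last /= -lp.
    by move=> k kp; have /(_ k kp) /andP[] := pathP (x, false) dp.
  exact: noodd fe.
have esymc : connect_sym e by apply: sym_connect_sym.
have lift r x : connect e r x ->
    connect d (r, false) (x, false) || connect d (r, false) (x, true).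
  case/connectP => p; elim/last_ind: p x => [|p z IH] x /=.
    by move=> _ ->; rewrite connect0.
  rewrite rcons_path last_rcons => /andP[ep ez] ->.
  case/orP: (IH _ ep erefl) => /connect_trans tr; apply/orP; [right|left];
    by apply/tr/connect1; rewrite /= ez.
exists (fun x => connect d (fingraph.root e x, false) (x, false)) => x y exy.
have rxy : fingraph.root e x = fingraph.root e y by apply/eqP; rewrite (root_connect esymc) connect1.
have rx : connect e (fingraph.root e x) x by rewrite esymc connect_root.
(* If both colours are true, going from [(y, false)] through the root to [(x, false)] and along the
   edge reaches [(y, true)]. If both are false, [lift] gives an odd walk from the root to [x], and
   the edge makes it an even walk to [y]. *)
apply/negP => /eqP; rewrite -rxy; case cx: (connect d _ _) => /esym cy.
  have := noloop y; rewrite (connect_trans (_ : connect d _ (fingraph.root e x, false))) //.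
    by rewrite dsym.
  by apply: connect_trans cx _; apply: connect1; rewrite /= exy.
case/orP: (lift _ _ rx) => [|cxt]; first by rewrite cx.
by rewrite (connect_trans cxt) // in cy; apply: connect1; rewrite /= exy.
Qed.

(** * Neighbourhoods and cliques *)

Definition nbr (G : sgraph) (v : G) : {set G} := [set y | edge v y].

Definition nbrs (G : sgraph) (X : {set G}) : {set G} :=
  [set y | [exists x in X, edge x y]].

Lemma nbrsP (G : sgraph) (X : {set G}) (y : G) :
  reflect (exists2 x, x \in X & edge x y) (y \in nbrs X).
Proof. by rewrite inE; apply: exists_inP. Qed.

Lemma claw_free_nbr (G : sgraph) (v a b c : G) : claw_free G ->
  edge v a -> edge v b -> edge v c -> a != b -> a != c -> b != c ->
  [|| edge a b, edge a c | edge b c].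
Proof.
move=> clawf va vb vc nab nac nbc; apply/negP => /negP.
rewrite !negb_or => /and3P[/negbTE eab /negbTE eac /negbTE ebc].
have ne x : edge v x -> (v == x) = false.
  by apply: contraTF => /eqP->; rewrite edge_irrefl.
apply: clawf.
exists (fun o : claw => if o is Some i then nth v [:: a; b; c] i else v).
  case=> [[[|[|[|//]]] i]|] [[[|[|[|//]]] j]|] //= /eqP; rewrite ?(eq_sym _ v) ?ne //;
    rewrite 1?(negbTE nab) 1?(negbTE nac) 1?(negbTE nbc) 1?eq_sym;
    rewrite 1?(negbTE nab) 1?(negbTE nac) 1?(negbTE nbc) // => _;
    by congr Some; apply: val_inj.
case=> [[[|[|[|//]]] i]|] [[[|[|[|//]]] j]|] //=;
  rewrite ?edge_irrefl ?va ?vb ?vc ?eab ?eac ?ebc // edge_sym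
    ?va ?vb ?vc ?eab ?eac ?ebc //.
Qed.

(** In the graph [h] of non-edges inside [nbr v], an induced triangle gives a claw at [v] and a
    longer induced odd cycle is an odd antihole. Hence [h] is two-colourable, and the larger colour
    class serves as [K]. *)
Lemma nbr_clique (G : sgraph) (v : G) : claw_free G -> berge G ->
  exists2 K : {set G}, #|nbr v| <= 2 * #|K| &
    {in K &, forall x y, x != y -> edge x y}.
Proof.
move=> clawf bg.
pose h : rel G := fun x y => [&& edge v x, edge v y & compl_edge x y].
have [||m f om m3 fi fh|c hc] := @two_colouring G h.
- by move=> x y; rewrite /h compl_edge_sym andbCA.
- by move=> x; rewrite /h compl_edge_irrefl !andbF.
(* Every vertex of the cycle has an [h]-edge to its successor, hence lies in [nbr v]. *)
- have fv i : edge v (f i).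
    suff : h (f i) (f (ordS i)) by case/andP.
    rewrite fh /cycle_edge eqxx andbT -val_eqE /= neq_ltn.
    have [im|im] := eqVneq i.+1 m; first by rewrite im modnn; lia.
    by rewrite modn_small; have := ltn_ord i; lia.
  have fhe i j : i != j -> edge (f i) (f j) = ~~ cycle_edge i j.
    move=> ij; rewrite -fh /h !fv /= /compl_edge negb_and negbK.
    by rewrite inj_eq // (negbTE ij) negbK.
  have [m4|] := leqP 4 m.
    have [_ []] := bg m om; split=> //; exists f => // i j.
    have [->|ij] := eqVneq i j; first by rewrite !edge_irrefl.
    by rewrite fhe //= /compl_edge ij.
  move=> m4; have em : m = 3 by lia.
  subst m.
  have := @claw_free_nbr G v (f (inord 0)) (f (inord 1)) (f (inord 2)) clawf.
  rewrite !fv !(inj_eq fi) !fhe -?val_eqE /= ?inordK //.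
  by rewrite /cycle_edge -?val_eqE /= ?inordK //= => /(_ isT isT isT isT isT isT).
have card_split :
    #|nbr v| = #|[set x in nbr v | c x]| + #|[set x in nbr v | ~~ c x]|.
  rewrite -(cardsID [set x | c x]); congr (_ + _);
    by apply: eq_card => x; rewrite !inE // andbC.
have cl x y : x \in nbr v -> y \in nbr v -> c x = c y -> x != y -> edge x y.
  rewrite !inE => vx vy cxy nxy; apply/negPn/negP => exy.
  by have := hc x y; rewrite /h vx vy /compl_edge nxy exy cxy eqxx => /(_ isT).
have [le|le] := leqP #|[set x in nbr v | ~~ c x]| #|[set x in nbr v | c x]|.
  exists [set x in nbr v | c x]; first by lia.
  move=> x y; rewrite inE => /andP[vx cx]; rewrite inE => /andP[vy cy].
  by apply: cl => //; rewrite cx.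
exists [set x in nbr v | ~~ c x]; first by lia.
move=> x y; rewrite inE => /andP[vx /negbTE cx]; rewrite inE => /andP[vy /negbTE cy].
by apply: cl => //; rewrite cx.
Qed.

(** * Covers of controlled size *)

(** Take [X] minimal among the sets reaching [k] in [B] or in [C]. Removing one vertex brings both
    counts below [k], and that vertex accounts for fewer than [d] neighbours. Taking [C] equal to
    [B] gives the version with one target. *)
Lemma grow_cover (G : sgraph) (A B C : {set G}) (k d : nat) :
  (forall v : G, #|nbr v| < d) -> 0 < k -> k <= #|nbrs A :&: B| ->
  exists X : {set G}, [/\ X \subset A,
    (k <= #|nbrs X :&: B|) || (k <= #|nbrs X :&: C|),
    #|nbrs X :&: B| < k + d & #|nbrs X :&: C| < k + d].
Proof.
move=> degd k0 kA.
pose P (X : {set G}) := (k <= #|nbrs X :&: B|) || (k <= #|nbrs X :&: C|).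
have [|X /minsetP[PX minX] XA] := @minset_exists _ P A; first by rewrite /P kA.
have [x xX] : exists x, x \in X.
  apply/set0Pn; apply: contraL PX => /eqP->; rewrite /P.
  have -> : nbrs set0 = set0 :> {set G}.
    by apply/setP => y; rewrite in_set0; apply/nbrsP => -[z]; rewrite inE.
  by rewrite !set0I !cards0 leqNgt k0.
have nPx : ~~ P (X :\ x).
  apply/negP => Px; have := minX _ Px (subsetDl _ _).
  by move=> /setP/(_ x); rewrite !inE eqxx xX.
have step D : #|nbrs X :&: D| <= #|nbrs (X :\ x) :&: D| + #|nbr x|.
  apply: leq_trans (leq_card_setU _ _); apply/subset_leq_card/subsetP => y.
  rewrite !in_setU !in_setI => /andP[/nbrsP[z zX zy] ->]; rewrite andbT.
  have [<-|nzx] := eqVneq z x; first by rewrite [y \in nbr _]inE zy orbT.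
  by apply/orP; left; apply/nbrsP; exists z => //; rewrite !inE nzx.
exists X; split=> //; move: nPx; rewrite /P negb_or -!ltnNge => /andP[nB nC];
  apply: leq_ltn_trans (step _) _; have := degd x; lia.
Qed.

Lemma edge_nbrsN (G : sgraph) (X : {set G}) (x y : G) :
  x \in X -> y \notin nbrs X -> edge x y = false.
Proof. by move=> xX; apply: contraNF => xy; apply/nbrsP; exists x. Qed.

Lemma disjoint_neq (T : finType) (A B : {set T}) (x y : T) :
  [disjoint A & B] -> x \in A -> y \in B -> x != y.
Proof. by move=> dAB xA; apply: contraTneq => <-; rewrite (disjointFr dAB). Qed.

Definition no_anticomplete_pair (G : sgraph) (t : nat) :=
  forall A B : {set G}, [disjoint A & B] -> t <= #|A| -> t <= #|B| ->
    exists x y, [/\ x \in A, y \in B & edge x y].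

(** The part of [B] that [A] misses is anticomplete to [A], hence has fewer than [t] vertices. *)
Lemma no_anticomplete_cover (G : sgraph) (t : nat) (A B : {set G}) :
  no_anticomplete_pair G t -> [disjoint A & B] -> t <= #|A| ->
  #|B| < #|nbrs A :&: B| + t.
Proof.
move=> pair dAB tA; rewrite -(cardsID (nbrs A) B) setIC ltn_add2l ltnNge.
apply/negP => tB; have [|x [y [xA]]] := pair _ _ _ tA tB.
  by apply: disjointWr dAB; apply: subsetDl.
by rewrite in_setD => /andP[yN _]; rewrite (edge_nbrsN xA yN).
Qed.

(** * Private neighbours *)

(** The vertex [x] is a ready-made claw leaf at [y]: it is distinct from and nonadjacent to any two
    further leaves chosen in [D]. *)
Definition private_nbrs (G : sgraph) (Y D : {set G}) :=
  forall y, y \in Y ->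
    exists2 x, edge y x & forall z, z \in D -> (x != z) && ~~ edge x z.

Lemma private_nbrsS (G : sgraph) (Y Y' D D' : {set G}) :
  Y' \subset Y -> D' \subset D -> private_nbrs Y D -> private_nbrs Y' D'.
Proof.
move=> sY sD priv y /(subsetP sY)/priv[x yx xD]; exists x => // z /(subsetP sD).
exact: xD.
Qed.

Lemma cover_private_nbrs (G : sgraph) (X D : {set G}) :
  [disjoint X & D] -> [disjoint nbrs X & D] -> private_nbrs (nbrs X) D.
Proof.
move=> dXD dND y /nbrsP[x xX xy]; exists x => [|z zD]; first by rewrite edge_sym.
by rewrite (disjoint_neq dXD) //= (@edge_nbrsN _ X) // (disjointFl dND).
Qed.

Lemma private_nbrs_edge (G : sgraph) (Y D : {set G}) (y z z' : G) :
  claw_free G -> private_nbrs Y D -> y \in Y -> z \in D -> z' \in D ->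
  z != z' -> edge y z -> edge y z' -> edge z z'.
Proof.
move=> clawf priv /priv[x yx xD] zD z'D zz' yz yz'.
have /andP[xz /negbTE exz] := xD _ zD; have /andP[xz' /negbTE exz'] := xD _ z'D.
by have := claw_free_nbr clawf yx yz yz' xz xz' zz'; rewrite exz exz'.
Qed.

(** For adjacent [y1] and [y2], a vertex of [Y3] sees both or neither ([tri1], [tri2]). So no edge
    joins the part of one set covered by [Z] to the uncovered part of the other, and one of these
    two pairs is large on both sides. *)
Lemma no_private_triple (G : sgraph) (t : nat) (Y1 Y2 Y3 : {set G}) :
  claw_free G -> 0 < t -> no_anticomplete_pair G t ->
  (forall v : G, #|nbr v| < 4 * t) ->
  [disjoint Y1 & Y2] -> [disjoint Y1 & Y3] -> [disjoint Y2 & Y3] ->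
  private_nbrs Y1 (Y2 :|: Y3) -> private_nbrs Y2 (Y1 :|: Y3) ->
  46 * t <= #|Y1| -> 46 * t <= #|Y2| -> 46 * t <= #|Y3| -> False.
Proof.
move=> clawf t0 pair deg d12 d13 d23 priv1 priv2 c1 c2 c3.
have tri1 y1 y2 z : y1 \in Y1 -> y2 \in Y2 -> z \in Y3 ->
    edge y1 y2 -> edge z y1 -> edge z y2.
  move=> yY1 yY2 zY e12; rewrite edge_sym => e1z; rewrite edge_sym.
  apply: (private_nbrs_edge clawf priv1 yY1) e12 e1z; rewrite ?inE ?yY2 ?zY ?orbT //.
  exact: disjoint_neq yY2 zY.
have tri2 y1 y2 z : y1 \in Y1 -> y2 \in Y2 -> z \in Y3 ->
    edge y1 y2 -> edge z y2 -> edge z y1.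
  move=> yY1 yY2 zY; rewrite edge_sym => e12; rewrite edge_sym => e2z.
  rewrite edge_sym.
  apply: (private_nbrs_edge clawf priv2 yY2) e12 e2z; rewrite ?inE ?yY1 ?zY ?orbT //.
  exact: disjoint_neq yY1 zY.
(* [Z] covers at least [10 * t] but fewer than [14 * t] vertices of [Y1], so both parts of [Y1]
   exceed [t]. *)
have [||Z [ZY kZ cZ _]] := @grow_cover G Y3 Y1 Y1 (10 * t) (4 * t) deg.
- by lia.
- have := @no_anticomplete_cover G t Y3 Y1 pair; rewrite disjoint_sym.
  by move=> /(_ d13); lia.
rewrite orbb in kZ.
have cD1 := cardsID (nbrs Z) Y1; have cD2 := cardsID (nbrs Z) Y2.
rewrite setIC in cD1; rewrite setIC in cD2.
have [cZ2|cZ2] := leqP t #|nbrs Z :&: Y2|.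
  have [|||y1 [y2 []]] := pair (Y1 :\: nbrs Z) (nbrs Z :&: Y2).
  - by rewrite disjoint_sym disjoint_setI_setD.
  - by lia.
  - by [].
  rewrite in_setD in_setI => /andP[/negP y1N y1Y] /andP[/nbrsP[z zZ ez] y2Y] e12.
  apply: y1N; apply/nbrsP; exists z => //.
  by apply: tri2 e12 ez => //; apply: (subsetP ZY).
have [|||y1 [y2 []]] := pair (nbrs Z :&: Y1) (Y2 :\: nbrs Z).
- exact: disjoint_setI_setD.
- by lia.
- by lia.
rewrite in_setD in_setI => /andP[/nbrsP[z zZ ez] y1Y] /andP[/negP y2N y2Y] e12.
apply: y2N; apply/nbrsP; exists z => //.
by apply: tri1 e12 ez => //; apply: (subsetP ZY).
Qed.

(** A set [X] grown in one half of [R] either covers much of [Y], where claws at [Y] forbid edges to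
    the uncovered part of the other half [B], or leaves a private triple. *)
Lemma no_private_pair (G : sgraph) (t : nat) (Y R : {set G}) :
  claw_free G -> 0 < t -> no_anticomplete_pair G t ->
  (forall v : G, #|nbr v| < 4 * t) ->
  [disjoint Y & R] -> private_nbrs Y R ->
  100 * t <= #|Y| -> 200 * t <= #|R| -> False.
Proof.
move=> clawf t0 pair deg dYR privY cY cR.
have [|A [B [AR BR dAB cA cB]]] := @disjoint_halves G R (100 * t); first by lia.
have [||X [XA kX cXB cXY]] := @grow_cover G A B Y (50 * t) (4 * t) deg.
- by lia.
- by have := no_anticomplete_cover pair dAB; lia.
have XR := subset_trans XA AR.
have cDB := cardsID (nbrs X) B; have cDY := cardsID (nbrs X) Y.
rewrite setIC in cDB; rewrite setIC in cDY.
have [cX|cX] := leqP (50 * t) #|nbrs X :&: Y|.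
  have [|||y [z []]] := pair (nbrs X :&: Y) (B :\: nbrs X); [|by lia|by lia|].
    exact: disjoint_setI_setD.
  rewrite in_setI in_setD => /andP[/nbrsP[x xX xy] yY] /andP[zN zB] yz.
  have := private_nbrs_edge clawf privY yY (subsetP XR _ xX) (subsetP BR _ zB).
  have -> : x != z by apply: disjoint_neq dAB _ _ => //; apply: (subsetP XA).
  by rewrite (edge_nbrsN xX zN) edge_sym xy yz => /(_ isT isT isT).
have sub : (nbrs X :&: B) :|: (B :\: nbrs X) \subset R.
  by apply: subset_trans BR; rewrite subUset subsetIr subsetDl.
apply: (@no_private_triple G t (Y :\: nbrs X) (nbrs X :&: B) (B :\: nbrs X)) => //.
- by rewrite disjoint_sym disjoint_setI_setD.
- apply: disjointWl (subsetDl _ _) _; apply: disjointWr dYR.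
  exact: subset_trans (subsetDl _ _) BR.
- exact: disjoint_setI_setD.
- exact: private_nbrsS (subsetDl _ _) sub privY.
- apply: private_nbrsS (subsetIl _ _) (subxx _) _; apply: cover_private_nbrs.
    rewrite -setI_eq0 setIUr setU_eq0 !setI_eq0; apply/andP; split.
      rewrite disjoint_sym; apply: disjointWl (subsetDl _ _) _.
      exact: disjointWr dYR.
    by apply: disjointWl XA _; apply: disjointWr dAB; apply: subsetDl.
  by rewrite -setDUl disjoint_setD.
- by lia.
- by lia.
- by lia.
Qed.

Lemma claw_free_degree (G : sgraph) (t : nat) :
  claw_free G -> 0 < t -> 1000 * t <= #|G| -> no_anticomplete_pair G t ->
  exists v : G, 4 * t <= #|nbr v|.
Proof.
move=> clawf t0 nt pair.
case: (boolP [exists v : G, 4 * t <= #|nbr v|]) => [/existsP//|/existsPn nodeg].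
have deg (v : G) : #|nbr v| < 4 * t by rewrite ltnNge nodeg.
have [|A [B [_ _ dAB cA cB]]] := @disjoint_halves G [set: G] (500 * t).
  by rewrite cardsT; lia.
(* The covered part of [B] has private neighbours in [X]; the uncovered part, above [396 * t], plays
   the role of [R]. *)
have [||X [XA kX cX _]] := @grow_cover G A B B (100 * t) (4 * t) deg.
- by lia.
- by have := no_anticomplete_cover pair dAB; lia.
rewrite orbb in kX; have cD := cardsID (nbrs X) B; rewrite setIC in cD.
case: (@no_private_pair G t (nbrs X :&: B) (B :\: nbrs X)) => //.
- exact: disjoint_setI_setD.
- apply: private_nbrsS (subsetIl _ _) (subxx _) _; apply: cover_private_nbrs.
    by apply: disjointWl XA _; apply: disjointWr dAB; apply: subsetDl.
  exact: disjoint_setD.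
- by lia.
Qed.

(** * The homogeneous pair and the constant *)

Lemma claw_free_berge_pair (G : sgraph) (t : nat) :
  claw_free G -> berge G -> 0 < t -> 1000 * t <= #|G| ->
  exists P Q : {set G}, [/\ homogeneous_pair P Q, t <= #|P| & t <= #|Q|].
Proof.
move=> clawf bg t0 nt.
case: (boolP [exists P : {set G}, [exists Q : {set G},
  [&& [disjoint P & Q], t <= #|P|, t <= #|Q| &
      [forall x in P, [forall y in Q, ~~ edge x y]]]]]).
  case/existsP=> P /existsP[Q /and4P[dPQ tP tQ /forall_inP no]].
  exists P, Q; split=> //; split=> //; right=> x y xP yQ.
  exact: (forall_inP (no x xP)).
move=> nopair; have [|v tv] := @claw_free_degree G t clawf t0 nt.
  move=> A B dAB tA tB.
  move: nopair; rewrite negb_exists => /forallP/(_ A).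
  rewrite negb_exists => /forallP/(_ B); rewrite dAB tA tB /=.
  rewrite negb_forall_in => /exists_inP[x xA].
  by rewrite negb_forall_in => /exists_inP[y yB]; rewrite negbK; exists x, y.
(* Degree [4 * t] gives a clique of size [2 * t], whose halves have size [t]. *)
have [K cK clK] := @nbr_clique G v clawf bg.
have [|P [Q [PK QK dPQ cP cQ]]] := @disjoint_halves G K t; first by lia.
exists P, Q; rewrite cP cQ; split=> //; split=> //; left=> x y xP yQ.
apply: clK; [exact: (subsetP PK) | exact: (subsetP QK) |].
by apply: contraTneq yQ => <-; rewrite (disjointFr dPQ).
Qed.

Theorem theorem1p5 (R : realType) :
  strong_erdos_hajnal R (fun G : sgraph => claw_free G /\ berge G).
Proof.
(* With [t] the floor of [#|G| / 1000] and [t] positive, [#|G| < 1000 * (t + 1) <= 2000 * t]. Below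
   1000 vertices, two singletons suffice. *)
exists (2000%:R^-1)%R; first by rewrite invr_gt0 ltr0n.
move=> G [clawf bg] n2.
have toR (k : nat) : #|G| <= 2000 * k -> (2000%:R^-1 * #|G|%:R <= k%:R :> R)%R.
  by move=> Gk; rewrite mulrC ler_pdivrMr ?ltr0n // -natrM ler_nat mulnC.
have [small|big] := ltnP #|G| 1000.
  have /card_gt1P[x [y [_ _ nxy]]] := n2.
  exists [set x], [set y]; rewrite !cards1; split; try by apply: toR; lia.
  split; first by rewrite disjoints1 inE.
  case exy: (edge x y); [left|right] => u w; rewrite !inE => /eqP-> /eqP->;
    by rewrite exy.
have [||P [Q [hPQ tP tQ]]] := @claw_free_berge_pair G (#|G| %/ 1000) clawf bg.
- by rewrite divn_gt0.
- by rewrite mulnC leq_trunc_div.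
exists P, Q; split=> //; apply: toR.
  by have := ltn_ceil #|G| (isT : 0 < 1000); lia.
by have := ltn_ceil #|G| (isT : 0 < 1000); lia.
Qed.
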